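(* Let $G=(V,E)$ be a locally finite and connected graph with symmetric weight and uniformly positive measure, and let $2\le p<\infty$. Assume that $a:V\to[0,+\infty)$ satisfies: $(A_1)$ $a(x)\ge 0$ and the potential well $\Omega=\{x\in V:a(x)=0\}$ is a non-empty, connected and bounded domain in $V$; $(A_2)$ there exists a vertex $x_0\in V$ such that $a(x)\to+\infty$ as $d(x,x_0)\to+\infty$. Let $(\lambda_k)$ be any sequence with $\lambda_k>1$ and $\lambda_k\to\infty$, and for each $k$ let $u_{\lambda_k}$ be a ground state solution of $$-\Delta u+(\lambda_k a(x)+1)u=|u|^{p-1}u\quad\text{in }V.$$ Then, up to a subsequence, $u_{\lambda_k}$ converges in $W^{1,2}(V)$ to a ground state solution (extended by zero to $V$) of the Dirichlet problem $$-\Delta u+u=|u|^{p-1}u\ \text{ in }\Omega,\qquad u=0\ \text{ on }\partial\Omega.$$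
   Context: A graph $G=(V,E)$ is locally finite if each $x\in V$ has only finitely many $y\in V$ with $xy\in E$; it is connected if any two vertices can be joined by finitely many edges. Each edge $xy\in E$ has a weight $w_{xy}>0$, symmetric if $w_{xy}=w_{yx}$. The measure $\mu:V\to(0,\infty)$ is uniformly positive if there is $\mu_{\min}>0$ with $\mu(x)\ge\mu_{\min}$ for all $x\in V$. The distance $d(x,y)$ is the minimal number of edges connecting $x$ and $y$. A domain is a subset $\Omega\subset V$; it is bounded if $d(x,y)$ is uniformly bounded above for $x,y\in\Omega$. Its boundary is $\partial\Omega=\{y\notin\Omega:\exists x\in\Omega\text{ with }xy\in E\}$. Write $y\sim x$ if $xy\in E$. For functions $u,v:V\to\mathbb{R}$: $$\Delta u(x)=\frac1{\mu(x)}\sum_{y\sim x}w_{xy}(u(y)-u(x)),\quad \Gamma(u,v)(x)=\frac1{2\mu(x)}\sum_{y\sim x}w_{xy}(u(y)-u(x))(v(y)-v(x)),\quad |\nabla u|^2=\Gamma(u,u),$$ and $\int_A u\,d\mu=\sum_{x\in A}\mu(x)u(x)$ for $A\subset V$. $C_c(V)$ is the set of functions on $V$ with finite (compact) support, and $W^{1,2}(V)$ is its completion under $\|u\|_{W^{1,2}(V)}=\left(\int_V(|\nabla u|^2+u^2)\,d\mu\right)^{1/2}$. For $\lambda>1$ set $E_\lambda=\{u\in W^{1,2}(V):\int_V\lambda a u^2d\mu<+\infty\}$ with norm $\|u\|_{E_\lambda}=\left(\int_V(|\nabla u|^2+(\lambda a+1)u^2)\,d\mu\right)^{1/2}$. Let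 $J_\lambda(u)=\frac12\|u\|_{E_\lambda}^2-\frac1{p+1}\int_V|u|^{p+1}d\mu$, $\mathcal{N}_\lambda=\{u\in E_\lambda\setminus\{0\}:\|u\|_{E_\lambda}^2=\int_V|u|^{p+1}d\mu\}$ and $m_\lambda=\inf_{\mathcal{N}_\lambda}J_\lambda$. A weak solution of $-\Delta u+(\lambda a+1)u=|u|^{p-1}u$ in $V$ is $u\in E_\lambda$ with $\int_V(\Gamma(u,\varphi)+(\lambda a+1)u\varphi)\,d\mu=\int_V|u|^{p-1}u\varphi\,d\mu$ for all $\varphi\in C_c(V)$; a ground state solution is a weak solution $u_\lambda\in\mathcal{N}_\lambda$ with $J_\lambda(u_\lambda)=m_\lambda$. $C_c(\Omega)$ is the set of functions with finite (compact) support in $\Omega$, extended by zero to $V$; $W_0^{1,2}(\Omega)$ is its completion under $\|u\|_{W_0^{1,2}(\Omega)}=\left(\int_{\Omega\cup\partial\Omega}|\nabla u|^2d\mu+\int_\Omega u^2d\mu\right)^{1/2}$. Let $J_\Omega(u)=\frac12\|u\|_{W_0^{1,2}(\Omega)}^2-\frac1{p+1}\int_\Omega|u|^{p+1}d\mu$, $\mathcal{N}_\Omega=\{u\in W_0^{1,2}(\Omega)\setminus\{0\}:\|u\|_{W_0^{1,2}(\Omega)}^2=\int_\Omega|u|^{p+1}d\mu\}$ and $m_\Omega=\inf_{\mathcal{N}_\Omega}J_\Omega$. A weak solution of the Dirichlet problem is $u\in W_0^{1,2}(\Omega)$ with $\int_{\Omega\cup\partial\Omega}\Gamma(u,\varphi)\,d\mu+\int_\Omega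 u\varphi\,d\mu=\int_\Omega|u|^{p-1}u\varphi\,d\mu$ for all $\varphi\in C_c(\Omega)$; a ground state solution is a weak solution $u_0\in\mathcal{N}_\Omega$ with $J_\Omega(u_0)=m_\Omega$. *)

(* Defs.v *)
From mathcomp Require Import all_boot all_order all_algebra.
From mathcomp Require Import all_classical all_reals all_analysis.

Set Implicit Arguments.
Unset Strict Implicit.
Unset Printing Implicit Defensive.

Import Order.TTheory GRing.Theory Num.Theory.
Import numFieldNormedType.Exports.

Local Open Scope classical_set_scope.
Local Open Scope ring_scope.

(* The weight [wt x y] is only meaningful when [adj x y]. *)
Record wgraph (R : realType) (V : choiceType) := WGraph {
  adj : rel V;
  adj_sym : symmetric adj;
  wt : V -> V -> R;
  wt_gt0 : forall x y, adj x y -> 0 < wt x y;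
  mu : V -> R;
  mu_gt0 : forall x, 0 < mu x
}.

Definition locally_finite (R : realType) (V : choiceType) (G : wgraph R V) :=
  forall x, finite_set [set y | adj G x y].

Definition symmetric_weight (R : realType) (V : choiceType) (G : wgraph R V) :=
  forall x y, adj G x y -> wt G x y = wt G y x.

Definition uniformly_positive (R : realType) (V : choiceType)
    (G : wgraph R V) :=
  exists mu_min : R, 0 < mu_min /\ forall x, mu_min <= mu G x.

(* Connectedness of the subgraph induced on A. *)
Definition connected_domain (R : realType) (V : choiceType) (G : wgraph R V)
    (A : set V) :=
  forall x y, A x -> A y ->
    exists s : seq V, [/\ path (adj G) x s, last x s = y &
                          forall z, z \in s -> A z].

Definition connected_graph (R : realType) (V : choiceType) (G : wgraph R V) :=
  connected_domain G setT.

Definition has_walk (R : realType) (V : choiceType) (G : wgraph R V)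
    (x y : V) : pred nat :=
  fun n => `[< exists s : seq V,
                 [/\ path (adj G) x s, last x s = y & size s = n] >].

(* Minimal number of edges joining x to y; 0 if no walk joins them, which
   does not happen in a connected graph. *)
Definition gdist (R : realType) (V : choiceType) (G : wgraph R V)
    (x y : V) : nat :=
  if pselect (exists n, has_walk G x y n) is left h then ex_minn h else 0%N.

Definition bounded_domain (R : realType) (V : choiceType) (G : wgraph R V)
    (A : set V) :=
  exists N : nat, forall x y, A x -> A y -> (gdist G x y <= N)%N.

Definition boundary (R : realType) (V : choiceType) (G : wgraph R V)
    (A : set V) : set V :=
  [set y | ~ A y /\ exists x, A x /\ adj G x y].

Definition gamma (R : realType) (V : choiceType) (G : wgraph R V)
    (u v : V -> R) (x : V) : R :=
  (2 * mu G x)^-1 *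
    \sum_(y \in [set y | adj G x y]) wt G x y * (u y - u x) * (v y - v x).

Definition gradsq (R : realType) (V : choiceType) (G : wgraph R V)
    (u : V -> R) : V -> R := gamma G u u.

(* [\esum] is a supremum of finite sums, correct for nonnegative terms only,
   hence the splitting into positive and negative parts, as for the Lebesgue
   integral. *)
Definition gint (R : realType) (V : choiceType) (G : wgraph R V)
    (A : set V) (f : V -> R) : \bar R :=
  (let g := fun x => (mu G x * f x)%:E in
   \esum_(x in A) g^\+ x - \esum_(x in A) g^\- x)%E.

Definition Cc (R : realType) (V : choiceType) (A : set V) : set (V -> R) :=
  [set f | finite_set [set x | f x != 0] /\ [set x | f x != 0] `<=` A].

(* Completion of C for the norm N, realised inside the functions on V. This is
   legitimate for the norms below: as the measure is bounded below, they
   dominate pointwise values and functions of finite norm form a complete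
   space, so that the completion is the closure of C in that space. *)
Definition completion (R : realType) (V : choiceType)
    (N : (V -> R) -> \bar R) (C : set (V -> R)) : set (V -> R) :=
  [set u | exists f : nat -> V -> R, (forall n, C (f n)) /\
      (fun n => N (f n \- u)) @ \oo --> 0%E].

Definition normW (R : realType) (V : choiceType) (G : wgraph R V)
    (u : V -> R) : \bar R :=
  sqrte (gint G setT (fun x => gradsq G u x + u x ^+ 2)).

Definition W12 (R : realType) (V : choiceType) (G : wgraph R V) :
    set (V -> R) := completion (normW G) (Cc setT).

Definition normE (R : realType) (V : choiceType) (G : wgraph R V)
    (lam : R) (a : V -> R) (u : V -> R) : \bar R :=
  sqrte (gint G setT
    (fun x => gradsq G u x + (lam * a x + 1) * u x ^+ 2)).

Definition Espace (R : realType) (V : choiceType) (G : wgraph R V)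
    (lam : R) (a : V -> R) : set (V -> R) :=
  [set u | W12 G u /\
    (gint G setT (fun x => (lam * a x) * u x ^+ 2)%R < +oo)%E].

Definition JE (R : realType) (V : choiceType) (G : wgraph R V)
    (p lam : R) (a : V -> R) (u : V -> R) : \bar R :=
  ((2^-1)%:E * normE G lam a u ^+ 2 -
   ((p + 1)^-1)%:E * gint G setT (fun x => `|u x| `^ (p + 1))%R)%E.

Definition NehariE (R : realType) (V : choiceType) (G : wgraph R V)
    (p lam : R) (a : V -> R) : set (V -> R) :=
  [set u | [/\ Espace G lam a u, u <> (fun=> 0) &
    (normE G lam a u ^+ 2 = gint G setT (fun x => `|u x| `^ (p + 1))%R)%E]].

Definition mE (R : realType) (V : choiceType) (G : wgraph R V)
    (p lam : R) (a : V -> R) : \bar R :=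
  ereal_inf (JE G p lam a @` NehariE G p lam a).

Definition weak_solutionE (R : realType) (V : choiceType) (G : wgraph R V)
    (p lam : R) (a : V -> R) (u : V -> R) :=
  Espace G lam a u /\
  forall phi, Cc setT phi ->
    gint G setT (fun x => gamma G u phi x + (lam * a x + 1) * u x * phi x) =
    gint G setT (fun x => `|u x| `^ (p - 1) * u x * phi x).

Definition ground_stateE (R : realType) (V : choiceType) (G : wgraph R V)
    (p lam : R) (a : V -> R) (u : V -> R) :=
  [/\ weak_solutionE G p lam a u, NehariE G p lam a u &
      JE G p lam a u = mE G p lam a].

Definition normD (R : realType) (V : choiceType) (G : wgraph R V)
    (Om : set V) (u : V -> R) : \bar R :=
  sqrte (gint G (Om `|` boundary G Om) (gradsq G u) +
         gint G Om (fun x => u x ^+ 2)%R)%E.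

(* The norm does not see u away from Om and its neighbourhood, so extension by
   zero has to be imposed. *)
Definition W012 (R : realType) (V : choiceType) (G : wgraph R V)
    (Om : set V) : set (V -> R) :=
  [set u | (forall x, ~ Om x -> u x = 0) /\
           completion (normD G Om) (Cc Om) u].

Definition JD (R : realType) (V : choiceType) (G : wgraph R V)
    (p : R) (Om : set V) (u : V -> R) : \bar R :=
  ((2^-1)%:E * normD G Om u ^+ 2 -
   ((p + 1)^-1)%:E * gint G Om (fun x => `|u x| `^ (p + 1))%R)%E.

Definition NehariD (R : realType) (V : choiceType) (G : wgraph R V)
    (p : R) (Om : set V) : set (V -> R) :=
  [set u | [/\ W012 G Om u, u <> (fun=> 0) &
    (normD G Om u ^+ 2 = gint G Om (fun x => `|u x| `^ (p + 1))%R)%E]].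

Definition mD (R : realType) (V : choiceType) (G : wgraph R V)
    (p : R) (Om : set V) : \bar R :=
  ereal_inf (JD G p Om @` NehariD G p Om).

Definition weak_solutionD (R : realType) (V : choiceType) (G : wgraph R V)
    (p : R) (Om : set V) (u : V -> R) :=
  W012 G Om u /\
  forall phi, Cc Om phi ->
    (gint G (Om `|` boundary G Om) (gamma G u phi) +
     gint G Om (fun x => u x * phi x)%R)%E =
    gint G Om (fun x => `|u x| `^ (p - 1) * u x * phi x).

Definition ground_stateD (R : realType) (V : choiceType) (G : wgraph R V)
    (p : R) (Om : set V) (u : V -> R) :=
  [/\ weak_solutionD G p Om u, NehariD G p Om u & JD G p Om u = mD G p Om].

Definition well (R : realType) (V : choiceType) (a : V -> R) : set V :=
  [set x | a x = 0].

Definition cvg_W12 (R : realType) (V : choiceType) (G : wgraph R V)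
    (u_ : nat -> V -> R) (u : V -> R) :=
  [/\ forall k, W12 G (u_ k), W12 G u &
      (fun k => normW G (u_ k \- u)) @ \oo --> 0%E].

(* Main.v *)
Require Import Defs.
From mathcomp Require Import all_boot all_order all_algebra.
From mathcomp Require Import all_classical all_reals all_analysis.
From mathcomp Require Import ring lra.
Import Order.TTheory GRing.Theory Num.Theory.
Import numFieldNormedType.Exports.
Local Open Scope classical_set_scope.
Local Open Scope ring_scope.

Set Implicit Arguments.
Unset Strict Implicit.
Unset Printing Implicit Defensive.

(** On functions supported in the well the potential disappears, so there the
    penalised functionals and the Dirichlet functional coincide. Hence the
    Dirichlet constraint is part of every penalised constraint and the penalised
    minimal energies stay below the Dirichlet one ([NehariD_sub],
    [ground_state_energy_le]). This bounds the norms of the ground states, the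
    penalising term included, independently of [lam k].

    Coercivity makes the well finite and keeps the potential above some [c > 0]
    off the well ([finite_well], [potential_gap]). The bounded penalising term
    therefore forces the mass off the well to be of order [1 / lam k]
    ([mass_off_le]), while on the finite well bounded sequences converge along
    a subsequence. Together the ground states converge at every vertex to a
    function [u0] supported in the well, and the equation, tested with functions
    supported in the well, is a system of finite sums that passes to the limit
    ([weak_equation_limit]).

    Pointwise convergence does not control the gradient at infinity, since the
    weights may be large compared with the measure. The missing control comes
    from the equation of the limit. Tested with itself it says that the energy
    of [u0] equals its [(p + 1)]-power, and both are limits of the energy and
    power of the ground states near the well. As the constraint equates total
    energy and total power, and the power off the well vanishes with the mass,
    no energy can remain far from the well ([tail_cvg]); this is convergence in
    norm.

    The limit is nonzero because every element of the constraint exceeds one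
    half somewhere in absolute value ([NehariE_large]) and convergence in norm
    is uniform. It has least energy because the energies of the ground states
    are at most that of every Dirichlet competitor ([limit_energy_le]). *)

(** * Powers of the absolute value *)

Section Powers.
Context {R : realType}.
Implicit Types (t p r : R).

Lemma powR_normD1 t p : 1 < p -> `|t| `^ (p + 1) = `|t| `^ (p - 1) * t * t.
Proof.
move=> p1; have -> : p + 1 = (p - 1) + 2%:R by ring.
rewrite powRD; last by apply/implyP => /eqP h; exfalso; move: p1; lra.
by rewrite powR_mulrn// real_normK ?num_real// expr2 mulrA.
Qed.

Lemma powR_le_self t r : 0 <= t -> t <= 1 -> 1 <= r -> t `^ r <= t.
Proof.
move=> t0 t1 r1; have [->|tn0] := eqVneq t 0.
  by rewrite powR0//; apply/eqP => h; move: r1; rewrite h; lra.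
by apply: ge1r_powR => //; rewrite t1 lt_neqAle eq_sym tn0 t0.
Qed.

Lemma powR_normD1_le p t : 2 <= p -> `|t| <= 1 ->
  `|t| `^ (p + 1) <= `|t| * t ^+ 2.
Proof.
move=> p2 t1; rewrite powR_normD1; last by move: p2; lra.
rewrite -mulrA -expr2 ler_wpM2r ?sqr_ge0//.
by apply: powR_le_self => //; move: p2; lra.
Qed.

(** Away from zero the power function is differentiable; at zero it is squeezed
    below the identity, which only works for exponents at least one. *)
Lemma continuous_norm_powR r : 1 <= r -> continuous (fun t : R => `|t| `^ r).
Proof.
move=> r1 t; have [->|t0] := eqVneq t 0.
  rewrite /continuous_at normr0 powR0; last first.
    by apply/eqP => h; move: r1; rewrite h; lra.
  apply: (@squeeze_cvgr _ _ _ _ (fun=> 0) (fun s : R => `|s|)).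
  - apply: (@filterS _ _ _ (fun s : R => `|s| < 1)).
      by move=> s s1; rewrite powR_ge0/= powR_le_self// ltW.
    apply: (@cvgr_norm_lt _ _ _ (nbhs (0 : R)) _ id 0); first exact: cvg_id.
    by rewrite normr0.
  - exact: cvg_cst.
  - rewrite -[X in _ --> X](@normr0 _ R).
    by apply: cvg_norm; exact: cvg_id.
apply: (@continuous_comp _ _ _ (fun s : R => `|s|) (fun s : R => s `^ r)).
  exact: norm_continuous.
apply: differentiable_continuous; apply/derivable1_diffP.
by apply: derivable_powR; rewrite in_itv/= normr_gt0 t0.
Qed.

End Powers.

(** * Sequences *)

Section SimultaneousExtraction.
Context {R : realType} {V : choiceType}.

Lemma increasing_seq_ge (h : nat -> nat) :
  {homo h : i j / (i < j)%N} -> forall n, (n <= h n)%N.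
Proof.
by move=> hh; elim=> // n ih; apply: (leq_ltn_trans ih); apply: hh.
Qed.

Lemma increasing_seq_cvg (h : nat -> nat) :
  {homo h : i j / (i < j)%N} -> h @ \oo --> \oo.
Proof.
move=> hh A [N _ NA]; exists N => // n /= Nn; apply: NA => /=.
exact: leq_trans Nn (increasing_seq_ge hh n).
Qed.

Lemma bolzano_weierstrass_seq (s : seq V) (u : nat -> V -> R) :
  (forall x, exists M, forall k, `|u k x| <= M) ->
  exists h : nat -> nat, {homo h : i j / (i < j)%N} /\
    exists l : V -> R, forall x, x \in s -> (u \o h) ^~ x @ \oo --> l x.
Proof.
move=> ub; elim: s => [|x s [h [hh [l hl]]]].
  by exists id; split => //; exists (fun=> 0).
have [|g gm /cvg_ex[lx glx]] := @bolzano_weierstrass R (fun k => u (h k) x).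
  have [M uM] := ub x; exists M; split; first exact: num_real.
  by move=> N MN k _ /=; apply: le_trans (uM _) (ltW MN).
have gh : {homo g : i j / (i < j)%N}.
  by move=> i j; rewrite !ltnNge; apply: contra; rewrite -!leEnat gm.
exists (h \o g); split; first by move=> i j ij; apply/hh/gh.
exists (fun y => if y == x then lx else l y) => y.
rewrite in_cons; case: eqP => [-> _|_ /= ys]; first exact: glx.
exact: (@cvg_comp _ _ _ g ((u \o h) ^~ y) _ _ _
  (increasing_seq_cvg gh) (hl _ ys)).
Qed.

Lemma bolzano_weierstrass_finite (A : set V) (u : nat -> V -> R) :
  finite_set A -> (forall x, exists M, forall k, `|u k x| <= M) ->
  exists h : nat -> nat, {homo h : i j / (i < j)%N} /\
    exists l : V -> R, forall x, A x -> (u \o h) ^~ x @ \oo --> l x.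
Proof.
move=> Afin ub; have [h [hh [l hl]]] :=
  bolzano_weierstrass_seq (finmap.enum_fset (fset_set A)) ub.
exists h; split => //; exists l => x Ax; apply: hl.
by rewrite in_fset_set// inE.
Qed.

End SimultaneousExtraction.

Lemma cvg_fsum (R : realType) (V : choiceType) (A : set V)
    (F : nat -> V -> R) (l : V -> R) : finite_set A ->
  (forall x, A x -> F ^~ x @ \oo --> l x) ->
  (fun k => \sum_(x \in A) F k x) @ \oo --> \sum_(x \in A) l x.
Proof.
move=> Afin Fl; pose s := finmap.enum_fset (fset_set A).
have sumE (f : V -> R) : \sum_(x \in A) f x = \sum_(x <- s | x \in s) f x.
  by rewrite fsbig_finite// -big_seq.
rewrite sumE (_ : (fun k => _) = fun k => \sum_(x <- s | x \in s) F k x).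
  apply: cvg_big => [|x xs]; first exact: add_continuous.
  by apply: Fl; move: xs; rewrite /s in_fset_set// inE.
by apply/funext => k; exact: sumE.
Qed.

(** * Integration over vertices *)

Section Integral.
Context {R : realType} {V : choiceType} (G : wgraph R V).
Implicit Types (A B : set V) (f g : V -> R).

Definition fint A f : R := \sum_(x \in A) mu G x * f x.

Lemma gintE A f : (forall x, A x -> 0 <= f x) ->
  gint G A f = \esum_(x in A) (mu G x * f x)%:E.
Proof.
move=> f0; have g0 x : A x -> (0 <= (mu G x * f x)%:E)%E.
  by move=> Ax; rewrite lee_fin mulr_ge0// ?f0// ltW// mu_gt0.
rewrite /gint [X in (_ - X)%E]esum1 => [|x Ax]; last first.
  by rewrite (ge0_funenegE g0)// inE.
by rewrite sube0; apply: eq_esum => x Ax; rewrite (ge0_funeposE g0)// inE.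
Qed.

Lemma gint_finite A f : finite_set A -> gint G A f = (fint A f)%:E.
Proof.
move=> Afin; rewrite /gint !esum_fset// /fint.
rewrite (_ : (fun x => _)^\+%E =
    fun x => (Num.max (mu G x * f x) 0)%:E); last first.
  by apply/funext => x; rewrite funeposE EFin_max.
rewrite (_ : (fun x => _)^\-%E =
    fun x => (Num.max (- (mu G x * f x)) 0)%:E); last first.
  by apply/funext => x; rewrite funenegE EFin_max EFinN.
rewrite !fsumEFin// -EFinB; congr EFin.
rewrite !fsbig_finite//= -sumrB; apply: eq_bigr => x _.
by rewrite !maxElt; case: ltP => ?; case: ltP => ?; lra.
Qed.

Lemma gint_ge0 A f : (forall x, A x -> 0 <= f x) -> (0 <= gint G A f)%E.
Proof.
move=> f0; rewrite gintE//; apply: esum_ge0 => x Ax.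
by rewrite lee_fin mulr_ge0// ?f0// ltW// mu_gt0.
Qed.

Lemma le_gint A f g : (forall x, A x -> 0 <= f x) ->
  (forall x, A x -> f x <= g x) -> (gint G A f <= gint G A g)%E.
Proof.
move=> f0 fg; rewrite !gintE// => [|x Ax]; last first.
  exact: le_trans (f0 _ Ax) (fg _ Ax).
by apply: le_esum => x Ax; rewrite lee_fin ler_pM2l ?mu_gt0// fg.
Qed.

Lemma gintD A f g :
  (forall x, A x -> 0 <= f x) -> (forall x, A x -> 0 <= g x) ->
  gint G A (f \+ g) = (gint G A f + gint G A g)%E.
Proof.
move=> f0 g0; rewrite !gintE// => [|x Ax]; last by rewrite addr_ge0// ?f0 ?g0.
rewrite -esumD; first by apply: eq_esum => x _; rewrite mulrDr EFinD.
- by move=> x Ax; rewrite lee_fin mulr_ge0 ?f0// ltW// mu_gt0.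
- by move=> x Ax; rewrite lee_fin mulr_ge0 ?g0// ltW// mu_gt0.
Qed.

Lemma gintZ A f c : 0 < c -> (forall x, A x -> 0 <= f x) ->
  gint G A (fun x => c * f x) = (c%:E * gint G A f)%E.
Proof.
move=> c0 f0; rewrite !gintE// => [|x Ax]; last by rewrite mulr_ge0 ?f0// ltW.
rewrite /esum -ereal_sup_pZl//; congr ereal_sup.
have sumZ X : finite_set X -> (\sum_(x \in X) (mu G x * (c * f x))%:E =
    c%:E * \sum_(x \in X) (mu G x * f x)%:E)%E.
  move=> Xfin; rewrite !fsumEFin// -EFinM mulr_fsumr; congr EFin.
  by apply: eq_fsbigr => x _; rewrite mulrCA.
apply/seteqP; split=> y /=.
  by move=> [X XA <-]; exists (\sum_(x \in X) (mu G x * f x)%:E)%E;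
    [exists X|rewrite sumZ//; case: XA].
by move=> [_ [X XA <-] <-]; exists X => //; rewrite sumZ//; case: XA.
Qed.

Lemma gint_split A f : (forall x, 0 <= f x) ->
  gint G setT f = (gint G A f + gint G (~` A) f)%E.
Proof.
move=> f0; rewrite !gintE// (esumID A) ?setTI// => x _.
by rewrite lee_fin mulr_ge0// ltW// mu_gt0.
Qed.

Lemma le_gint_subset A B f : (forall x, 0 <= f x) -> A `<=` B ->
  (gint G A f <= gint G B f)%E.
Proof.
move=> f0 AB; rewrite !gintE// [leLHS]esum_mkcond [leRHS]esum_mkcond.
apply: le_esum => x _; case: ifPn; case: ifPn => //.
- by rewrite notin_setE inE => nB /AB.
- by move=> _ _; rewrite lee_fin mulr_ge0// ltW// mu_gt0.
Qed.

Lemma gint_support A B f : A `<=` B -> (forall x, ~ A x -> f x = 0) ->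
  gint G B f = gint G A f.
Proof.
move=> AB f0; rewrite /gint; congr (_ - _)%E;
  rewrite [LHS]esum_mkcond [RHS]esum_mkcond; apply: eq_esum => x _;
  case: ifPn; case: ifPn => //; rewrite ?notin_setE ?inE.
- by move=> /f0 fx _; rewrite funeposE fx mulr0 maxxx.
- by move=> /AB.
- by move=> /f0 fx _; rewrite funenegE fx mulr0 oppe0 maxxx.
- by move=> /AB.
Qed.

Lemma fint_support A B f : A `<=` B -> (forall x, ~ A x -> f x = 0) ->
  fint B f = fint A f.
Proof.
move=> AB f0; apply/esym/fsbig_widen => // x [_ nAx].
by rewrite /preimage/= f0// mulr0.
Qed.

Lemma eq_fint A f g : (forall x, A x -> f x = g x) -> fint A f = fint A g.
Proof. by move=> fg; apply: eq_fsbigr => x; rewrite inE => /fg ->. Qed.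

Lemma eq_gint A f g : (forall x, A x -> f x = g x) -> gint G A f = gint G A g.
Proof.
move=> fg; rewrite /gint; congr (_ - _)%E; apply: eq_esum => x Ax.
  by rewrite !funeposE fg.
by rewrite !funenegE fg.
Qed.

Lemma fintD A f g : finite_set A -> fint A (f \+ g) = fint A f + fint A g.
Proof.
move=> Afin; rewrite /fint !fsbig_finite// -big_split/=.
by apply: eq_bigr => x _; rewrite mulrDr.
Qed.

Lemma fintZ A f c : fint A (fun x => c * f x) = c * fint A f.
Proof.
by rewrite /fint mulr_fsumr; apply: eq_fsbigr => x _; rewrite mulrCA.
Qed.

Lemma fint_cvg A (F : nat -> V -> R) f : finite_set A ->
  (forall x, A x -> F ^~ x @ \oo --> f x) ->
  (fun k => fint A (F k)) @ \oo --> fint A f.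
Proof.
by move=> Afin Ff; apply: cvg_fsum => // x Ax; apply: cvgMr; exact: Ff.
Qed.

Lemma gint_point A x f : (forall y, 0 <= f y) -> A x ->
  ((mu G x * f x)%:E <= gint G A f)%E.
Proof.
move=> f0 Ax; apply: le_trans (@le_gint_subset [set x] A _ f0 _) => [|_ ->//].
by rewrite gint_finite// /fint fsbig_set1.
Qed.

End Integral.

(** * Gradients *)

Section Gradient.
Context {R : realType} {V : choiceType} (G : wgraph R V).
Hypothesis Glf : locally_finite G.
Implicit Types (A : set V) (u v phi : V -> R).

Lemma gradsq_ge0 u x : 0 <= gradsq G u x.
Proof.
apply: mulr_ge0; first by rewrite invr_ge0 mulr_ge0// ltW// mu_gt0.
apply: fsumr_ge0 => y /= xy; rewrite -mulrA mulr_ge0//.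
  by rewrite ltW// wt_gt0.
by rewrite -expr2 sqr_ge0.
Qed.

Lemma eq_gamma_nbhs u v phi x : u x = v x ->
  (forall y, adj G x y -> u y = v y) -> gamma G u phi x = gamma G v phi x.
Proof.
move=> ux uv; congr (_ * _); apply: eq_fsbigr => y; rewrite inE/= => xy.
by rewrite ux uv.
Qed.

Lemma gammaC u v x : gamma G u v x = gamma G v u x.
Proof. by congr (_ * _); apply: eq_fsbigr => y _; rewrite mulrAC. Qed.

Lemma eq_gradsq_nbhs u v x : u x = v x ->
  (forall y, adj G x y -> u y = v y) -> gradsq G u x = gradsq G v x.
Proof.
move=> ux uv; rewrite /gradsq (@eq_gamma_nbhs u v)// gammaC.
by rewrite (@eq_gamma_nbhs u v).
Qed.

(** The gradient of a function supported in [A] lives on the vertices of [A]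
    and their neighbours. *)
Definition thicken A := A `|` boundary G A.

Lemma subset_thicken A : A `<=` thicken A.
Proof. by move=> x; left. Qed.

Lemma notin_thicken A x : ~ thicken A x ->
  ~ A x /\ forall y, adj G x y -> ~ A y.
Proof.
move=> nx; have nA : ~ A x by move=> Ax; apply: nx; left.
split=> // y xy Ay; apply: nx; right; split => //.
by exists y; rewrite adj_sym.
Qed.

Lemma finite_thicken A : finite_set A -> finite_set (thicken A).
Proof.
move=> Afin; rewrite finite_setU; split => //.
apply: (@sub_finite_set _ _ (\bigcup_(x in A) [set y | adj G x y])).
  by move=> y [_ [x [Ax xy]]]; exists x.
by apply: bigcup_finite => // x _; exact: Glf.
Qed.

Lemma gamma_support A u phi x : (forall y, ~ A y -> phi y = 0) ->
  ~ thicken A x -> gamma G u phi x = 0.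
Proof.
move=> phi0 /notin_thicken[nA nbA].
rewrite /gamma fsbig1 ?mulr0// => y /= xy.
by rewrite !phi0 ?subrr ?mulr0//; exact: nbA.
Qed.

Lemma gamma_cvg (u v : nat -> V -> R) (u0 v0 : V -> R) x :
  (forall y, u ^~ y @ \oo --> u0 y) -> (forall y, v ^~ y @ \oo --> v0 y) ->
  (fun k => gamma G (u k) (v k) x) @ \oo --> gamma G u0 v0 x.
Proof.
move=> uu0 vv0; apply: cvgMr; apply: cvg_fsum; first exact: Glf.
move=> y _; apply: cvgM; last by apply: cvgB; exact: vv0.
by apply: cvgMr; apply: cvgB; exact: uu0.
Qed.

Lemma gradsqZ t u x : gradsq G (fun y => t * u y) x = t ^+ 2 * gradsq G u x.
Proof.
rewrite /gradsq /gamma [RHS]mulrCA; congr (_ * _).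
by rewrite mulr_fsumr; apply: eq_fsbigr => y _; ring.
Qed.

Lemma gradsq_sub u v x :
  gradsq G u x <= 2 * gradsq G v x + 2 * gradsq G (v \- u) x.
Proof.
rewrite /gradsq /gamma [in leRHS]mulrCA [X in _ + X]mulrCA -mulrDr.
rewrite ler_pM2l; last first.
  by rewrite invr_gt0 mulr_gt0// mu_gt0.
rewrite !mulr_fsumr !fsbig_finite//; try exact: Glf.
rewrite -big_split/= !big_seq; apply: ler_sum => y.
rewrite in_fset_set ?inE/=; last exact: Glf.
move=> xy; rewrite -!mulrA (mulrCA 2) (mulrCA 2 (wt G x y)) -mulrDr.
rewrite ler_pM2l ?wt_gt0//.
set a := u y; set b := u x; set c := v y; set d := v x.
(* [2 * s ^ 2 + 2 * (s - r) ^ 2 - r ^ 2] is the square of [s + (s - r)]. *)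
have := sqr_ge0 ((c - d) + ((c - d) - (a - b))); nra.
Qed.

End Gradient.

(** * Coercive potentials *)

Section Coercivity.
Context {R : realType} {V : choiceType} (G : wgraph R V).
Hypothesis Glf : locally_finite G.
Hypothesis Gconn : connected_graph G.

Lemma gdist_walk x y : has_walk G x y (gdist G x y).
Proof.
rewrite /gdist; case: pselect => [h|[]]; first by case: ex_minnP.
have [s [xs sy _]] := Gconn (x := x) (y := y) I I.
by exists (size s); apply/asboolP; exists s.
Qed.

Lemma finite_has_walk y n : finite_set [set x | has_walk G x y n].
Proof.
elim: n => [|n ih].
  apply: (@sub_finite_set _ _ [set y]) => // x /asboolP[s [_ + /size0nil s0]].
  by rewrite s0.
apply: (@sub_finite_set _ _
  (\bigcup_(z in [set z | has_walk G z y n]) [set x | adj G z x])).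
  move=> x /asboolP[[|z s] [//= /andP[xz zs] sy [sn]]].
  exists z; last by rewrite /= adj_sym.
  by apply/asboolP; exists s.
by apply: bigcup_finite => // z _; exact: Glf.
Qed.

Lemma finite_ball y n : finite_set [set x | (gdist G x y < n)%N].
Proof.
apply: (@sub_finite_set _ _
  (\bigcup_(m in `I_n) [set x | has_walk G x y m])).
  by move=> x /= xn; exists (gdist G x y) => //; exact: gdist_walk.
by apply: bigcup_finite => [|m _]; [exact: finite_II|exact: finite_has_walk].
Qed.

Lemma finite_set_pos_lbound (A : set V) (a : V -> R) : finite_set A ->
  (forall x, A x -> 0 < a x) ->
  exists2 c, 0 < c & forall x, A x -> c <= a x.
Proof.
move=> /finite_seqP[s ->] {A}; elim: s => [|x s ih] a0; first by exists 1.
have [|c c0 ca] := ih.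
  by move=> y ys; apply: a0; rewrite /= in_cons ys orbT.
exists (Num.min c (a x)).
  by rewrite lt_min c0 a0//= in_cons eqxx.
move=> y; rewrite /= in_cons => /predU1P[->|ys].
  by rewrite ge_min lexx orbT.
by rewrite ge_min ca.
Qed.

Variable a : V -> R.
Hypothesis a_ge0 : forall x, 0 <= a x.
Hypothesis a_coercive : exists x0 : V, forall M : R, exists N : nat,
  forall x, (N <= gdist G x x0)%N -> M <= a x.

Lemma finite_sublevel M : finite_set [set x | a x < M].
Proof.
have [x0 /(_ M)[N aM]] := a_coercive.
apply: sub_finite_set (finite_ball x0 N).
by move=> x /=; rewrite ltNge ltnNge; apply: contra => /aM.
Qed.

Lemma finite_well : finite_set (well a).
Proof.
by apply: sub_finite_set (finite_sublevel 1) => x /= ->; rewrite ltr01.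
Qed.

(** Only finitely many values of the potential are below one, hence its
    positive values cannot accumulate at zero. *)
Lemma potential_gap : exists2 c, 0 < c & forall x, ~ well a x -> c <= a x.
Proof.
have [||c c0 ca] := @finite_set_pos_lbound ([set x | a x < 1] `\` well a) a.
- by apply: finite_setD; exact: finite_sublevel.
- by move=> x [_ /eqP ax]; rewrite lt_neqAle eq_sym ax a_ge0.
exists (Num.min c 1); first by rewrite lt_min c0 ltr01.
move=> x nx; rewrite ge_min; case: (ltP (a x) 1) => a1; last by rewrite orbT.
by rewrite ca.
Qed.

End Coercivity.

(** * Norms *)

Lemma completion_self (R : realType) (V : choiceType)
    (N : (V -> R) -> \bar R) (C : set (V -> R)) v :
  N (fun=> 0) = 0%E -> C v -> completion N C v.
Proof.
move=> N0 Cv; exists (fun=> v); split => //.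
rewrite (_ : (fun=> _) = fun=> 0%E); first exact: cvg_cst.
apply/funext => _; rewrite -[RHS]N0; congr N.
by apply/funext => x /=; rewrite subrr.
Qed.

Section Norms.
Context {R : realType} {V : choiceType} (G : wgraph R V).
Hypothesis Glf : locally_finite G.
Implicit Types (A : set V) (u v phi : V -> R).

Lemma gradsq_cst0 x : gradsq G (fun=> 0) x = 0.
Proof.
by rewrite /gradsq /gamma fsbig1 ?mulr0// => y _; rewrite subrr mulr0.
Qed.

Definition densW u x := gradsq G u x + u x ^+ 2.

Lemma densW_ge0 u x : 0 <= densW u x.
Proof. by rewrite addr_ge0 ?gradsq_ge0 ?sqr_ge0. Qed.

Lemma densW_support A u x : (forall y, ~ A y -> u y = 0) ->
  ~ thicken G A x -> densW u x = 0.
Proof.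
move=> u0 nx; have [nA _] := notin_thicken nx.
by rewrite /densW /gradsq (gamma_support _ u0)// u0// expr0n addr0.
Qed.

Lemma normW_sqrte u : normW G u = sqrte (gint G setT (densW u)).
Proof. by []. Qed.

Lemma normE_sqr lam (a : V -> R) u : 0 <= lam -> (forall x, 0 <= a x) ->
  (normE G lam a u ^+ 2 = gint G setT (densW u) +
    gint G setT (fun x => (lam * a x) * u x ^+ 2)%R)%E.
Proof.
move=> l0 a0; have la0 x : 0 <= lam * a x * u x ^+ 2.
  by rewrite mulr_ge0 ?sqr_ge0// mulr_ge0.
rewrite sqr_sqrte => [|]; last first.
  rewrite gint_ge0// => x _; rewrite addr_ge0 ?gradsq_ge0//.
  by rewrite mulrDl mul1r addr_ge0 ?sqr_ge0.
rewrite -gintD => [||x _]; [|by move=> x _; exact: densW_ge0|exact: la0].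
by apply: eq_gint => x _; rewrite /densW/=; ring.
Qed.

Lemma normW0 : normW G (fun=> 0) = 0%E.
Proof.
rewrite normW_sqrte gintE => [|x _]; last exact: densW_ge0.
rewrite esum1 ?sqrte0// => x _.
by rewrite /densW gradsq_cst0 expr0n addr0 mulr0.
Qed.

Lemma gint_densW_finite A u : finite_set A -> (forall y, ~ A y -> u y = 0) ->
  gint G setT (densW u) = (fint G (thicken G A) (densW u))%:E.
Proof.
move=> Afin u0; rewrite (@gint_support _ _ _ (thicken G A))//.
  by rewrite gint_finite//; exact: finite_thicken.
by move=> x; exact: densW_support.
Qed.

Lemma densW_sub u v x : densW u x <= 2 * densW v x + 2 * densW (v \- u) x.
Proof.
(* The same completed square as for the gradient. *)
rewrite /densW; have := gradsq_sub Glf u v x.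
have := sqr_ge0 (v x + (v x - u x)); rewrite /=; nra.
Qed.

(** An element of the completion differs by a function of finite norm from a
    finitely supported one. *)
Lemma W12_fin_num u : W12 G u -> gint G setT (densW u) \is a fin_num.
Proof.
move=> [f [Cf /fine_cvgP[[N _ fN] _]]].
have := fN N (leqnn N); rewrite normW_sqrte sqrte_fin_num; last first.
  by rewrite gint_ge0// => x _; exact: densW_ge0.
move=> fin_fu; have [Ffin _] := Cf N.
have fin_f : gint G setT (densW (f N)) \is a fin_num.
  rewrite (@gint_densW_finite [set x | f N x != 0])// => y /negP.
  by rewrite negbK => /eqP.
rewrite ge0_fin_numE; last by rewrite gint_ge0// => x _; exact: densW_ge0.
apply: (@le_lt_trans _ _
    (gint G setT (fun x => 2 * densW (f N) x + 2 * densW (f N \- u) x)%R)).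
  by apply: le_gint => x _; [exact: densW_ge0|exact: densW_sub].
rewrite gintD => [|x _|x _]; last 2 first.
- by rewrite mulr_ge0 ?densW_ge0.
- by rewrite mulr_ge0 ?densW_ge0.
rewrite !gintZ//; last 2 first.
- by move=> x _; exact: densW_ge0.
- by move=> x _; exact: densW_ge0.
by rewrite ltey_eq fin_numD !fin_numM.
Qed.

End Norms.

(** * Functions supported in the well *)

Section Dirichlet.
Context {R : realType} {V : choiceType} (G : wgraph R V).
Hypothesis Glf : locally_finite G.
Variables (a : V -> R) (p : R).
Hypothesis a_ge0 : forall x, 0 <= a x.
Hypothesis well_fin : finite_set (well a).
Hypothesis p_ge2 : 2 <= p.
Implicit Types (u v phi : V -> R) (lam : R).

Local Notation Om := (well a).
Local Notation B := (thicken G (well a)).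

Let B_fin : finite_set B.
Proof. exact: finite_thicken. Qed.

Definition supported v := forall x, ~ Om x -> v x = 0.

(** For functions supported in the well these are the total energy and power,
    written as finite sums; for others only the part close to the well. *)
Definition energy v : R := fint G B (densW G v).
Definition power v : R := fint G B (fun x => `|v x| `^ (p + 1)).

Lemma powR_supported v x : supported v -> ~ Om x -> `|v x| `^ (p + 1) = 0.
Proof.
move=> v0 nx; rewrite v0// normr0 powR0//.
by apply/eqP => h; move: p_ge2; rewrite -subr_ge0; lra.
Qed.

Lemma normW_supported v : supported v ->
  gint G setT (densW G v) = (energy v)%:E.
Proof. exact: gint_densW_finite. Qed.

Lemma normE_supported lam v : 0 <= lam -> supported v ->
  (normE G lam a v ^+ 2 = (energy v)%:E)%E.
Proof.
move=> l0 v0; rewrite normE_sqr// normW_supported// gintE => [|x _]; last first.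
  by rewrite mulr_ge0 ?sqr_ge0// mulr_ge0.
rewrite esum1 ?adde0// => x _.
have [ax|/eqP ax] := eqVneq (a x) 0; first by rewrite ax mulr0 mul0r mulr0.
by rewrite v0// expr0n/= !mulr0.
Qed.

Lemma normD_supported v : supported v -> (normD G Om v ^+ 2 = (energy v)%:E)%E.
Proof.
move=> v0; rewrite sqr_sqrte; last first.
  apply: adde_ge0; apply: gint_ge0 => x _; last exact: sqr_ge0.
  exact: gradsq_ge0.
rewrite !gint_finite// -EFinD; congr EFin.
rewrite -(@fint_support _ _ _ Om B).
- by rewrite -fintD.
- exact: subset_thicken.
- by move=> x nx; rewrite v0// expr0n.
Qed.

Lemma gint_powR_supported v : supported v ->
  gint G setT (fun x => `|v x| `^ (p + 1)) = (power v)%:E.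
Proof.
move=> v0; rewrite (@gint_support _ _ _ Om)// => [|x]; last first.
  exact: powR_supported.
rewrite gint_finite//; congr EFin; apply/esym/fint_support => [|x].
  exact: subset_thicken.
exact: powR_supported.
Qed.

Lemma gint_powR_well v : supported v ->
  gint G Om (fun x => `|v x| `^ (p + 1)) = (power v)%:E.
Proof.
move=> v0; rewrite -gint_powR_supported//; apply/esym/gint_support => // x.
exact: powR_supported.
Qed.

Lemma Cc_supported v : supported v <-> Cc Om v.
Proof.
split=> [v0|[_ vOm] x nx]; last first.
  by apply/eqP; apply: contra_notT nx; exact: vOm.
have vOm : [set x | v x != 0] `<=` Om.
  by move=> x /= /eqP vx; apply: contrapT => /v0.
by split => //; exact: sub_finite_set vOm _.
Qed.

Lemma W12_supported v : supported v -> W12 G v.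
Proof.
move=> /Cc_supported[vfin _]; apply: completion_self; first exact: normW0.
by split.
Qed.

Lemma W012_supported v : W012 G Om v <-> supported v.
Proof.
split=> [[v0 _]//|v0]; split => //; apply: completion_self; last first.
  exact/Cc_supported.
have : (normD G Om (fun=> 0%R) ^+ 2 = 0)%E.
  rewrite normD_supported//; congr EFin; rewrite /energy /fint fsbig1// => x _.
  by rewrite /densW gradsq_cst0 expr0n addr0 mulr0.
by move/eqP; rewrite expe_eq0/= => /eqP.
Qed.

Lemma NehariDE v :
  NehariD G p Om v <-> [/\ supported v, v <> (fun=> 0) & energy v = power v].
Proof.
split=> [[/W012_supported v0 vn0]|[v0 vn0 EP]].
  by rewrite normD_supported// gint_powR_well// => -[].
split => //; first exact/W012_supported.
by rewrite normD_supported// gint_powR_well// EP.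
Qed.

Lemma JDE v : supported v ->
  JD G p Om v = (2^-1 * energy v - (p + 1)^-1 * power v)%:E.
Proof. by move=> v0; rewrite /JD normD_supported// gint_powR_well. Qed.

Lemma JE_supported lam v : 0 <= lam -> supported v ->
  JE G p lam a v = JD G p Om v.
Proof.
by move=> l0 v0; rewrite JDE// /JE normE_supported// gint_powR_supported.
Qed.

(** The penalising term vanishes on functions supported in the well, so the
    constraint of the Dirichlet problem is contained in that of every
    penalised problem. *)
Lemma NehariD_sub lam : 0 <= lam -> NehariD G p Om `<=` NehariE G p lam a.
Proof.
move=> l0 v /NehariDE[v0 vn0 EP]; split => //.
  split; first exact: W12_supported.
  rewrite (@gint_support _ _ _ set0)//; last first.
    move=> x _; have [ax|/eqP ax] := eqVneq (a x) 0.
      by rewrite ax mulr0 mul0r.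
    by rewrite v0// expr0n/= !mulr0.
  by rewrite gint_finite// ltry.
by rewrite normE_supported// gint_powR_supported// EP.
Qed.

Let c := 2^-1 - (p + 1)^-1.

Let c_gt0 : 0 < c.
Proof.
rewrite subr_gt0 ltf_pV2 ?posrE//; move: p_ge2; lra.
Qed.

Lemma mE_le_energy lam v : 0 <= lam -> NehariD G p Om v ->
  (mE G p lam a <= (c * energy v)%:E)%E.
Proof.
move=> l0 Nv; have [v0 _ EP] := (NehariDE v).1 Nv.
apply: ereal_inf_lbound; exists v; first exact: NehariD_sub.
by rewrite JE_supported// JDE// -EP -mulrBl.
Qed.

Lemma mD_minimizer v : NehariD G p Om v ->
  (forall w, NehariD G p Om w -> energy v <= energy w) ->
  JD G p Om v = mD G p Om.
Proof.
move=> Nv vmin; apply/eqP; rewrite eq_le; apply/andP; split; last first.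
  by apply: ereal_inf_lbound; exists v.
apply: le_ereal_inf_tmp => _ [w Nw <-].
have [v0 _ EPv] := (NehariDE v).1 Nv; have [w0 _ EPw] := (NehariDE w).1 Nw.
by rewrite !JDE// -EPv -EPw -!mulrBl lee_fin ler_pM2l// vmin.
Qed.

(** A point mass is brought onto the constraint by rescaling, as the two sides
    are homogeneous of different degrees. *)
Lemma NehariD_neq0 : well a !=set0 -> NehariD G p Om !=set0.
Proof.
move=> [x ax]; pose d y : R := (y == x)%:R.
have dE y : y <> x -> d y = 0 by move=> /eqP/negbTE; rewrite /d => ->.
have d0 : supported d by move=> y ny; apply: dE => yx; apply: ny; rewrite yx.
have dx : d x = 1 by rewrite /d eqxx.
have xB : B x by left.
have mux := mu_gt0 G x.
have Ed_gt0 : 0 < energy d.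
  rewrite /energy /fint (fsbigD1 x)//= ltr_wpDr//.
    by apply: fsumr_ge0 => y _; rewrite mulr_ge0 ?densW_ge0 ?ltW ?mu_gt0.
  by rewrite mulr_gt0// /densW dx expr1n ltr_wpDl// gradsq_ge0.
(* Scaling by [t] multiplies energy by [t ^ 2] and power by [t ^ (p + 1)], so
   [t ^ (p - 1)] has to be the ratio of energy to power. *)
pose q := p - 1.
have q1 : 1 <= q by rewrite /q; move: p_ge2; lra.
pose s := energy d / mu G x.
have s0 : 0 < s by rewrite divr_gt0.
pose t := s `^ q^-1.
have t0 : 0 < t by rewrite powR_gt0.
have tq : t `^ q = s.
  by rewrite /t -powRrM mulVf ?powRr1 ?ltW// gt_eqF// (lt_le_trans ltr01).
exists (fun y => t * d y); apply/NehariDE; split.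
- by move=> y /d0 ->; rewrite mulr0.
- move=> /(congr1 (@^~ x)) /= /eqP; rewrite dx mulr1 => /eqP tE.
  by move: t0; rewrite tE ltxx.
have -> : energy (fun y => t * d y) = t ^+ 2 * energy d.
  rewrite /energy -fintZ; apply: eq_fint => y _.
  by rewrite /densW gradsqZ exprMn mulrDr.
have -> : power (fun y => t * d y) = mu G x * t `^ (p + 1).
  rewrite /power (@fint_support _ _ _ [set x] B); last 2 first.
  - by move=> _ ->.
  - move=> y /dE ->; rewrite mulr0 normr0 powR0//.
    by apply/eqP => h; move: p_ge2 h; lra.
  by rewrite /fint fsbig_set1 dx mulr1 gtr0_norm.
have -> : t `^ (p + 1) = s * t ^+ 2.
  have -> : p + 1 = q + 2%:R by rewrite /q; ring.
  rewrite powRD ?tq ?powR_mulrn// ?ltW//.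
  by apply/implyP => _; rewrite gt_eqF.
by rewrite /s; field; rewrite gt_eqF.
Qed.

End Dirichlet.

(** * Ground states of the penalised problem *)

Section GroundStates.
Context {R : realType} {V : choiceType} (G : wgraph R V).
Hypothesis Glf : locally_finite G.
Variables (a : V -> R) (p : R).
Hypothesis a_ge0 : forall x, 0 <= a x.
Hypothesis well_fin : finite_set (well a).
Hypothesis p_ge2 : 2 <= p.
Implicit Types (u v phi : V -> R) (lam : R).

Local Notation Om := (well a).
Local Notation B := (thicken G (well a)).

Let B_fin : finite_set B.
Proof. exact: finite_thicken. Qed.

Let pen_ge0 lam u x : 0 <= lam -> 0 <= lam * a x * u x ^+ 2.
Proof. by move=> l0; rewrite mulr_ge0 ?sqr_ge0// mulr_ge0. Qed.

Lemma penalty_fin_num lam u : 0 <= lam -> Espace G lam a u ->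
  gint G setT (fun x => (lam * a x) * u x ^+ 2) \is a fin_num.
Proof.
move=> l0 [_ pen]; rewrite ge0_fin_numE// gint_ge0// => x _.
exact: pen_ge0.
Qed.

(** On a small function the superlinear term is dominated by half the quadratic
    one, which is incompatible with the constraint. *)
Lemma NehariE_large lam u : 0 <= lam -> NehariE G p lam a u ->
  exists x, 2^-1 < `|u x|.
Proof.
move=> l0 [Eu un0 EP]; apply: contrapT => /forallNP small.
have {}small x : `|u x| <= 2^-1 by rewrite leNgt; apply/negP/small.
have Dfin := W12_fin_num Glf Eu.1; have pfin := penalty_fin_num l0 Eu.
have D0 x : 0 <= densW G u x by exact: densW_ge0.
have : (gint G setT (densW G u) +
    gint G setT (fun x => (lam * a x) * u x ^+ 2)%R <=
    2^-1%:E * gint G setT (densW G u))%E.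
  rewrite -normE_sqr// EP -gintZ//.
  apply: le_gint => x _; first exact: powR_ge0.
  apply: (le_trans (powR_normD1_le p_ge2 _)).
    by apply: le_trans (small x) _; lra.
  apply: (@le_trans _ _ (2^-1 * u x ^+ 2)).
    by rewrite ler_wpM2r ?sqr_ge0.
  by rewrite ler_pM2l ?invr_gt0// /densW lerDr gradsq_ge0.
have [x ux] : exists x, u x != 0.
  apply: contrapT => /forallNP u0; apply: un0; apply/funext => x.
  by apply/eqP/negPn/negP/u0.
have := @gint_point _ _ G setT x (densW G u) D0 I.
have pen0 : (0 <= gint G setT (fun x => (lam * a x) * u x ^+ 2)%R)%E.
  by apply: gint_ge0 => y _; exact: pen_ge0.
have : 0 < mu G x * densW G u x.
  by rewrite mulr_gt0 ?mu_gt0// /densW ltr_wpDl ?gradsq_ge0// exprn_even_gt0.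
move: pen0; rewrite -(fineK Dfin) -(fineK pfin) -EFinM -EFinD !lee_fin.
lra.
Qed.

(** Both energies are the same multiple of the squared norm on their
    constraints, so comparing the infima compares the norms. *)
Lemma ground_state_energy_le lam u w : 0 <= lam ->
  ground_stateE G p lam a u -> NehariD G p Om w ->
  (gint G setT (densW G u) + gint G setT (fun x => (lam * a x) * u x ^+ 2)%R
    <= (energy G a w)%:E)%E.
Proof.
move=> l0 [_ [Eu _ EP] JEm] Nw.
have Dfin := W12_fin_num Glf Eu.1; have pfin := penalty_fin_num l0 Eu.
have := mE_le_energy Glf a_ge0 well_fin p_ge2 l0 Nw.
rewrite -JEm /JE -EP normE_sqr// -(fineK Dfin) -(fineK pfin) -EFinD.
rewrite !lee_fin -mulrBl ler_pM2l//.
by rewrite subr_gt0 ltf_pV2 ?posrE//; move: p_ge2; lra.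
Qed.

Lemma mass_off_well lam c u : 0 <= lam -> 0 <= c ->
  (forall x, ~ Om x -> c <= a x) ->
  0 < lam * c ->
  ((lam * c)%:E * gint G (~` Om) (fun x => u x ^+ 2)%R <=
    gint G setT (fun x => (lam * a x) * u x ^+ 2)%R)%E.
Proof.
move=> l0 c0 ca lc0; rewrite -gintZ// => [|x _]; last exact: sqr_ge0.
apply: (@le_trans _ _ (gint G (~` Om) (fun x => (lam * a x) * u x ^+ 2)%R)).
  apply: le_gint => x nx; first by rewrite mulr_ge0 ?sqr_ge0// ltW.
  by rewrite ler_wpM2r ?sqr_ge0// ler_wpM2l// ca.
by apply: le_gint_subset => // x; exact: pen_ge0.
Qed.

(** Without its penalising term the constraint says that energy is at most
    power, and off the well power is at most mass as the function is at most
    one there. *)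
Lemma Nehari_tail_le lam u : 0 <= lam -> NehariE G p lam a u ->
  (forall x, ~ Om x -> `|u x| <= 1) ->
  ((energy G a u)%:E + gint G (~` B) (densW G u) <=
    (power G a p u)%:E + gint G (~` Om) (fun x => u x ^+ 2)%R)%E.
Proof.
move=> l0 [_ _ EP] u1; have D0 x : 0 <= densW G u x by exact: densW_ge0.
have pen0 : (0 <= gint G setT (fun x => (lam * a x) * u x ^+ 2)%R)%E.
  by apply: gint_ge0 => y _; exact: pen_ge0.
rewrite -gint_finite// -gint_finite// -gint_split//.
apply: (@le_trans _ _ (gint G setT (fun x => `|u x| `^ (p + 1)))).
  by rewrite -EP normE_sqr// leeDl.
rewrite (@gint_split _ _ _ B) => [|x]; last exact: powR_ge0.
rewrite leeD2l//; apply: (@le_trans _ _ (gint G (~` B) (fun x => u x ^+ 2)%R)).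
  apply: le_gint => x nB; first exact: powR_ge0.
  have nx : ~ Om x by move=> xOm; apply: nB; left.
  apply: (le_trans (powR_normD1_le p_ge2 (u1 _ nx))).
  by rewrite ler_piMl ?sqr_ge0// u1.
by apply: le_gint_subset => [x|x nB xOm]; [exact: sqr_ge0|apply: nB; left].
Qed.

(** Test functions supported in the well do not see the potential, so weak
    solutions for different values of [lam] satisfy one and the same finite
    system of equations. *)
Lemma weak_equation lam u phi : weak_solutionE G p lam a u ->
  supported a phi ->
  fint G B (fun x => gamma G u phi x + u x * phi x) =
  fint G Om (fun x => `|u x| `^ (p - 1) * u x * phi x).
Proof.
move=> [_ wu] phi0; have [phifin _] := (Cc_supported well_fin phi).1 phi0.
have := wu phi (conj phifin (fun _ _ => I)).
rewrite (@gint_support _ _ _ B)//; last first.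
  move=> x nB; rewrite (gamma_support _ phi0)// phi0 ?mulr0 ?addr0//.
  by have [] := notin_thicken nB.
rewrite (@gint_support _ _ _ Om setT)// => [|x nx]; last first.
  by rewrite phi0// mulr0.
rewrite !gint_finite// => -[<-]; apply: eq_fint => x _.
have [->|/eqP ax] := eqVneq (a x) 0; first by rewrite mulr0 add0r mul1r.
by rewrite !phi0// !mulr0.
Qed.

Lemma weak_solutionD_supported v : supported a v ->
  (forall phi, supported a phi ->
    fint G B (fun x => gamma G v phi x + v x * phi x) =
    fint G Om (fun x => `|v x| `^ (p - 1) * v x * phi x)) ->
  weak_solutionD G p Om v.
Proof.
move=> v0 wv; split; first exact/W012_supported.
move=> phi /(Cc_supported well_fin phi) phi0; rewrite !gint_finite// -wv//.
rewrite -(@fint_support _ _ _ Om B); last 2 first.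
- exact: subset_thicken.
- by move=> x nx; rewrite phi0// mulr0.
by rewrite -EFinD -fintD.
Qed.

(** A supported solution may be used as its own test function. *)
Lemma weak_solution_energy v : supported a v ->
  fint G B (fun x => gamma G v v x + v x * v x) =
    fint G Om (fun x => `|v x| `^ (p - 1) * v x * v x) ->
  energy G a v = power G a p v.
Proof.
move=> v0 wv.
have -> : power G a p v = fint G Om (fun x => `|v x| `^ (p - 1) * v x * v x).
  rewrite /power (@fint_support _ _ _ Om B); last 2 first.
  - exact: subset_thicken.
  - by move=> x; exact: powR_supported.
  by apply: eq_fint => x _; apply: powR_normD1; move: p_ge2; lra.
by rewrite -wv; apply: eq_fint => x _; rewrite /densW expr2.
Qed.

Section Limit.
Variables (U : nat -> V -> R) (u0 : V -> R).
Hypothesis Uu0 : forall x, U ^~ x @ \oo --> u0 x.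

Let sqr_cvg (f : nat -> R) (l : R) :
  f @ \oo --> l -> (fun k => f k ^+ 2) @ \oo --> l ^+ 2.
Proof. by move=> fl; apply: cvgM. Qed.

Lemma densW_cvg (W : nat -> V -> R) w x : (forall y, W ^~ y @ \oo --> w y) ->
  (fun k => densW G (W k) x) @ \oo --> densW G w x.
Proof.
by move=> Ww; apply: cvgD; [exact: gamma_cvg|exact/sqr_cvg/Ww].
Qed.

Lemma energy_cvg : (fun k => energy G a (U k)) @ \oo --> energy G a u0.
Proof. by apply: fint_cvg => // x _; exact: densW_cvg. Qed.

Lemma norm_powR_cvg r x : 1 <= r ->
  (fun k => `|U k x| `^ r) @ \oo --> `|u0 x| `^ r.
Proof.
move=> r1.
exact: continuous_cvg (@continuous_norm_powR R r r1 (u0 x)) (@Uu0 x).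
Qed.

Lemma power_cvg : (fun k => power G a p (U k)) @ \oo --> power G a p u0.
Proof.
by apply: fint_cvg => // x _; apply: norm_powR_cvg; move: p_ge2; lra.
Qed.

Lemma weak_equation_limit (lam : nat -> R) phi :
  (forall k, weak_solutionE G p (lam k) a (U k)) -> supported a phi ->
  fint G B (fun x => gamma G u0 phi x + u0 x * phi x) =
  fint G Om (fun x => `|u0 x| `^ (p - 1) * u0 x * phi x).
Proof.
move=> wU phi0; have lhs : (fun k => fint G B
    (fun x => gamma G (U k) phi x + U k x * phi x)) @ \oo -->
    fint G B (fun x => gamma G u0 phi x + u0 x * phi x).
  apply: fint_cvg => // x _; apply: cvgD.
    by apply: gamma_cvg => // y; exact: cvg_cst.
  by apply: cvgMl; exact: Uu0.
have rhs : (fun k => fint G Om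
    (fun x => `|U k x| `^ (p - 1) * U k x * phi x)) @ \oo -->
    fint G Om (fun x => `|u0 x| `^ (p - 1) * u0 x * phi x).
  apply: fint_cvg => // x _; apply: cvgMl; apply: cvgM; last exact: Uu0.
  by apply: norm_powR_cvg; move: p_ge2; lra.
have E : (fun k => fint G B (fun x => gamma G (U k) phi x + U k x * phi x)) =
    fun k => fint G Om (fun x => `|U k x| `^ (p - 1) * U k x * phi x).
  by apply/funext => k; exact: weak_equation (wU k) phi0.
by rewrite E in lhs; apply: cvg_unique lhs rhs.
Qed.

(** Subtracting a function supported in the well leaves the energy density
    outside the thickened well unchanged. *)
Lemma normW_sub_supported k : supported a u0 ->
  gint G setT (densW G (U k \- u0)) =
  ((energy G a (U k \- u0))%:E + gint G (~` B) (densW G (U k)))%E.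
Proof.
move=> u00; rewrite (@gint_split _ _ _ B) => [|x]; last exact: densW_ge0.
rewrite gint_finite//; congr (_ + _)%E; apply: eq_gint => x nB.
have [nx nbx] := notin_thicken nB.
rewrite /densW /= u00// subr0 (@eq_gradsq_nbhs _ _ _ _ (U k))//=.
  by rewrite u00// subr0.
by move=> y /nbx ny; rewrite u00// subr0.
Qed.

Lemma energy_sub_cvg : (fun k => energy G a (U k \- u0)) @ \oo --> (0 : R).
Proof.
have -> : (0 : R) = energy G a (fun=> 0).
  rewrite /energy /fint fsbig1// => x _.
  by rewrite /densW gradsq_cst0 expr0n addr0 mulr0.
apply: fint_cvg => // x _; apply: densW_cvg => y /=.
by rewrite -(subrr (u0 y)); apply: cvgB; [exact: Uu0|exact: cvg_cst].
Qed.

End Limit.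

End GroundStates.

(** * Passage to the limit *)

Section GroundStateSequences.
Context {R : realType} {V : choiceType} (G : wgraph R V).
Hypothesis Glf : locally_finite G.
Variables (a : V -> R) (p : R).
Hypothesis a_ge0 : forall x, 0 <= a x.
Hypothesis well_fin : finite_set (well a).
Hypothesis p_ge2 : 2 <= p.
Variables (lam : nat -> R) (U : nat -> V -> R).
Hypothesis lam_gt1 : forall k, 1 < lam k.
Hypothesis U_gs : forall k, ground_stateE G p (lam k) a (U k).
Variable w : V -> R.
Hypothesis w_Nehari : NehariD G p (well a) w.

Local Notation Om := (well a).
Local Notation B := (thicken G (well a)).

Let lam_ge0 k : 0 <= lam k.
Proof. by rewrite ltW// (lt_trans ltr01). Qed.

Let energy_le k := ground_state_energy_le Glf a_ge0 well_fin p_ge2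
  (lam_ge0 k) (U_gs k) w_Nehari.

Let pen_ge0 k : (0 <= gint G setT (fun x => (lam k * a x) * U k x ^+ 2)%R)%E.
Proof.
by apply: gint_ge0 => x _; rewrite mulr_ge0 ?sqr_ge0// mulr_ge0.
Qed.

Let densW_int_ge0 A k : (0 <= gint G A (densW G (U k)))%E.
Proof. by apply: gint_ge0 => x _; exact: densW_ge0. Qed.

Lemma densW_int_le k : (gint G setT (densW G (U k)) <= (energy G a w)%:E)%E.
Proof. exact: le_trans (leeDl _ (pen_ge0 k)) (energy_le k). Qed.

Lemma energy_in_well_le k : energy G a (U k) <= energy G a w.
Proof.
rewrite -lee_fin; apply: le_trans (densW_int_le k).
rewrite -gint_finite; last exact: finite_thicken.
by apply: le_gint_subset => // x; exact: densW_ge0.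
Qed.

Lemma ground_states_pointwise_bounded x : exists M, forall k, `|U k x| <= M.
Proof.
(* The energy of [w] bounds [mu x * (u x) ^ 2], and [t <= 1 + t ^ 2]. *)
exists (1 + energy G a w / mu G x) => k.
have : U k x ^+ 2 <= energy G a w / mu G x.
  rewrite ler_pdivlMr ?mu_gt0// mulrC -lee_fin.
  apply: le_trans (densW_int_le k).
  apply: (le_trans _ (@gint_point _ _ _ setT x _ (@densW_ge0 _ _ G (U k)) I)).
  by rewrite lee_fin ler_pM2l ?mu_gt0// /densW lerDr gradsq_ge0.
have := sqr_ge0 (`|U k x| - 2^-1); rewrite -(real_normK (num_real (U k x))).
by move: (energy G a w / mu G x) => C; nra.
Qed.

Lemma mass_off_well_fin_num k :
  gint G (~` Om) (fun x => U k x ^+ 2) \is a fin_num.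
Proof.
rewrite ge0_fin_numE; last by apply: gint_ge0 => x _; exact: sqr_ge0.
apply: le_lt_trans (ltry (energy G a w)); apply: le_trans (densW_int_le k).
apply: (@le_trans _ _ (gint G setT (fun x => U k x ^+ 2)%R)).
  by apply: le_gint_subset => // x; exact: sqr_ge0.
by apply: le_gint => x _; rewrite ?sqr_ge0// /densW lerDr gradsq_ge0.
Qed.

Definition mass_off k := fine (gint G (~` Om) (fun x => U k x ^+ 2)).

Lemma mass_off_ge0 k : 0 <= mass_off k.
Proof. by rewrite fine_ge0// gint_ge0// => x _; exact: sqr_ge0. Qed.

Lemma mass_off_point k x : ~ Om x -> mu G x * U k x ^+ 2 <= mass_off k.
Proof.
move=> nx; rewrite -lee_fin fineK; last exact: mass_off_well_fin_num.
by apply: (@gint_point _ _ G _ x (fun y => U k y ^+ 2)) => // y; exact: sqr_ge0.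
Qed.

Variable c : R.
Hypothesis c_gt0 : 0 < c.
Hypothesis a_gap : forall x, ~ Om x -> c <= a x.

(** The energy of [w] bounds the penalising term, which on mass off the well is
    at least [c * lam k] times that mass. *)
Lemma mass_off_le k : mass_off k <= energy G a w * (c * lam k)^-1.
Proof.
have lc : 0 < lam k * c by rewrite mulr_gt0// (lt_trans ltr01).
rewrite (mulrC c) ler_pdivlMr// -lee_fin EFinM fineK; last first.
  exact: mass_off_well_fin_num.
rewrite muleC; apply: (le_trans (mass_off_well G a_ge0 (U k) (lam_ge0 k)
  (ltW c_gt0) a_gap lc)).
exact: le_trans (leeDr _ (densW_int_ge0 setT k)) (energy_le k).
Qed.

Hypothesis lam_infty : lam @ \oo --> +oo.

Lemma mass_off_cvg : mass_off @ \oo --> (0 : R).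
Proof.
apply: (@squeeze_cvgr _ _ _ _ (fun=> 0)
  (fun k => energy G a w * (c * lam k)^-1)).
- by apply: nearW => k; rewrite mass_off_ge0 mass_off_le.
- exact: cvg_cst.
- rewrite -[X in _ --> X](mulr0 (energy G a w)); apply: cvgMr.
  apply/gtr0_cvgV0.
    by apply: nearW => k; rewrite mulr_gt0// (lt_trans ltr01).
  apply/cvgryPge => M; move/cvgryPge: lam_infty => /(_ (M / c)).
  by apply: filterS => k; rewrite ler_pdivrMr// mulrC.
Qed.

Lemma cvg_off_well x : ~ Om x -> U ^~ x @ \oo --> (0 : R).
Proof.
move=> nx; apply/norm_cvg0P.
have : (fun k => Num.sqrt (mass_off k / mu G x)) @ \oo --> (0 : R).
  rewrite -[X in _ --> X](sqrtr0 R) -[X in Num.sqrt X](mul0r (mu G x)^-1).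
  apply: continuous_cvg; first exact: sqrt_continuous.
  by apply: cvgMl; exact: mass_off_cvg.
apply: squeeze_cvgr (cvg_cst 0); apply: nearW => k; rewrite normr_ge0/=.
rewrite -sqrtr_sqr ler_wsqrtr// ler_pdivlMr ?mu_gt0// mulrC.
exact: mass_off_point.
Qed.

Variable u0 : V -> R.
Hypothesis u0_supp : supported a u0.
Hypothesis U_u0 : forall x, U ^~ x @ \oo --> u0 x.

Let u0_weak phi : supported a phi ->
  fint G B (fun x => gamma G u0 phi x + u0 x * phi x) =
  fint G Om (fun x => `|u0 x| `^ (p - 1) * u0 x * phi x).
Proof.
move=> phi0; have wU k : weak_solutionE G p (lam k) a (U k) by case: (U_gs k).
exact: (weak_equation_limit Glf well_fin p_ge2 U_u0 wU phi0).
Qed.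

Lemma limit_energy_power : energy G a u0 = power G a p u0.
Proof. by apply: weak_solution_energy => //; exact: u0_weak. Qed.

Definition tail k := fine (gint G (~` B) (densW G (U k))).

Lemma tail_fin_num k : gint G (~` B) (densW G (U k)) \is a fin_num.
Proof.
rewrite ge0_fin_numE//; apply: le_lt_trans (ltry (energy G a w)).
apply: le_trans (densW_int_le k).
by apply: le_gint_subset => // x; exact: densW_ge0.
Qed.

Variable mu_min : R.
Hypothesis mu_min_gt0 : 0 < mu_min.
Hypothesis mu_ge : forall x, mu_min <= mu G x.

(** Inside, energy and power converge to the equal energy and power of the
    limit, so no energy is left for the outside. *)
Lemma tail_cvg : tail @ \oo --> (0 : R).
Proof.
apply: (@squeeze_cvgr _ _ _ _ (fun=> 0)
  (fun k => power G a p (U k) - energy G a (U k) + mass_off k)).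
- have : \forall k \near \oo, mass_off k <= mu_min.
    exact: (cvgr_le _ mass_off_cvg).
  apply: filterS => k mk; rewrite fine_ge0//=.
  have U1 x : ~ Om x -> `|U k x| <= 1.
    move=> nx; rewrite -(@expr_le1 _ 2)// real_normK ?num_real//.
    rewrite -(ler_pM2l (mu_gt0 G x)) mulr1.
    exact: le_trans (mass_off_point k nx) (le_trans mk (mu_ge x)).
  have [_ NU _] := U_gs k.
  have := Nehari_tail_le Glf a_ge0 well_fin p_ge2 (lam_ge0 k) NU U1.
  rewrite -(fineK (tail_fin_num k)) -(fineK (mass_off_well_fin_num k)).
  by rewrite -!EFinD lee_fin -/(tail k) -/(mass_off k); lra.
- exact: cvg_cst.
- have -> : (0 : R) = power G a p u0 - energy G a u0 + 0.
    by rewrite limit_energy_power subrr addr0.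
  apply: cvgD; last exact: mass_off_cvg.
  by apply: cvgB; [exact: power_cvg|exact: energy_cvg].
Qed.

Definition dist_sqr k := energy G a (U k \- u0) + tail k.

Lemma normW_dist k : normW G (U k \- u0) = (Num.sqrt (dist_sqr k))%:E.
Proof.
rewrite normW_sqrte (normW_sub_supported Glf well_fin U)//.
by rewrite -(fineK (tail_fin_num k)).
Qed.

Lemma dist_sqr_cvg : dist_sqr @ \oo --> (0 : R).
Proof.
rewrite -[X in _ --> X](addr0 0).
by apply: cvgD; [exact: energy_sub_cvg|exact: tail_cvg].
Qed.

Lemma normW_cvg : (fun k => normW G (U k \- u0)) @ \oo --> 0%E.
Proof.
rewrite (_ : (fun k => _) = fun k => (Num.sqrt (dist_sqr k))%:E); last first.
  by apply/funext => k; exact: normW_dist.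
apply: cvg_EFin; first exact: nearW.
rewrite -[X in _ --> X](sqrtr0 R).
by apply: continuous_cvg; [exact: sqrt_continuous|exact: dist_sqr_cvg].
Qed.

(** Convergence in norm is uniform as the measure is bounded below, while each
    ground state is somewhere larger than one half. *)
Lemma limit_neq0 : u0 <> (fun=> 0).
Proof.
move=> u00; have : \forall k \near \oo, dist_sqr k < mu_min * (2^-1) ^+ 2.
  by apply: (cvgr_lt _ dist_sqr_cvg); rewrite mulr_gt0.
move=> [N _ /(_ N (leqnn N))] /=; apply/negP; rewrite -leNgt.
have [_ NU _] := U_gs N.
have [x Ux] := NehariE_large Glf a_ge0 p_ge2 (lam_ge0 N) NU.
have : mu G x * U N x ^+ 2 <= dist_sqr N.
  rewrite -lee_fin; have -> : (dist_sqr N)%:E = gint G setT (densW G (U N)).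
    have -> : U N = U N \- u0 by apply/funext => y; rewrite u00 /= subr0.
    by rewrite (normW_sub_supported Glf well_fin U)// -(fineK (tail_fin_num N)).
  apply: (le_trans _ (@gint_point _ _ _ setT x _ (@densW_ge0 _ _ G (U N)) I)).
  by rewrite lee_fin ler_pM2l ?mu_gt0// /densW lerDr gradsq_ge0.
apply: le_trans; apply: ler_pM => //; first exact: ltW.
by rewrite -(real_normK (num_real (U N x))) lerXn2r ?nnegrE// ltW.
Qed.

Lemma limit_Nehari : NehariD G p Om u0.
Proof.
apply/NehariDE => //; split => //; first exact: limit_neq0.
exact: limit_energy_power.
Qed.

Lemma limit_weak_solution : weak_solutionD G p Om u0.
Proof. by apply: weak_solutionD_supported => // phi; exact: u0_weak. Qed.

Lemma limit_energy_le : energy G a u0 <= energy G a w.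
Proof.
apply: (ler_cvg_to (energy_cvg Glf well_fin U_u0) (cvg_cst _)).
by apply: nearW => k; exact: energy_in_well_le.
Qed.

End GroundStateSequences.

Theorem theorem1p3 (R : realType) (V : choiceType) (G : wgraph R V)
    (Glf : locally_finite G) (Gconn : connected_graph G)
    (Gsym : symmetric_weight G) (Gmu : uniformly_positive G)
    (p : R) (p_ge2 : 2 <= p)
    (a : V -> R) (a_ge0 : forall x, 0 <= a x)
    (well_neq0 : well a !=set0)
    (well_conn : connected_domain G (well a))
    (well_bnd : bounded_domain G (well a))
    (a_coercive : exists x0 : V, forall M : R, exists N : nat,
        forall x, (N <= gdist G x x0)%N -> M <= a x)
    (lam : nat -> R) (lam_gt1 : forall k, 1 < lam k)
    (lam_infty : lam @ \oo --> +oo)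
    (u : nat -> V -> R)
    (u_gs : forall k, ground_stateE G p (lam k) a (u k)) :
  exists h : nat -> nat, {homo h : i j / (i < j)%N} /\
    exists u0 : V -> R, cvg_W12 G (u \o h) u0 /\
      ground_stateD G p (well a) u0.
Proof.
have well_fin := finite_well Glf Gconn a_coercive.
have [c c0 a_gap] := potential_gap Glf Gconn a_ge0 a_coercive.
have [m [m0 mu_ge]] := Gmu.
have [w Nw] := NehariD_neq0 Glf well_fin p_ge2 well_neq0.
have [h [hh [l hl]]] := bolzano_weierstrass_finite well_fin
  (ground_states_pointwise_bounded Glf a_ge0 well_fin p_ge2 lam_gt1 u_gs Nw).
have lamh_infty : lam \o h @ \oo --> +oo.
  exact: cvg_comp (increasing_seq_cvg hh) lam_infty.
have lamh_gt1 k : 1 < (lam \o h) k by exact: lam_gt1.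
have uh_gs k : ground_stateE G p ((lam \o h) k) a ((u \o h) k) by exact: u_gs.
pose u0 x := if x \in well a then l x else 0.
have u0_supp : supported a u0.
  by move=> x nx; rewrite /u0 ifF//; apply/negbTE; rewrite notin_setE.
have uh_u0 x : (u \o h) ^~ x @ \oo --> u0 x.
  rewrite /u0; case: ifPn; first by rewrite inE => /hl.
  rewrite notin_setE => nx.
  exact: (cvg_off_well Glf a_ge0 well_fin p_ge2 lamh_gt1 uh_gs Nw c0 a_gap
    lamh_infty nx).
have Nu0 : NehariD G p (well a) u0.
  exact: (limit_Nehari Glf a_ge0 well_fin p_ge2 lamh_gt1 uh_gs Nw c0 a_gap
    lamh_infty u0_supp uh_u0 m0 mu_ge).
exists h; split => //; exists u0; split.
  split.
  - by move=> k; have [_ [[]]] := uh_gs k.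
  - exact: W12_supported u0_supp.
  - exact: (normW_cvg Glf a_ge0 well_fin p_ge2 lamh_gt1 uh_gs Nw c0 a_gap
      lamh_infty u0_supp uh_u0 m0 mu_ge).
split => //.
  exact: (limit_weak_solution Glf well_fin p_ge2 uh_gs u0_supp uh_u0).
apply: (mD_minimizer Glf well_fin p_ge2) => // v Nv.
exact: (limit_energy_le Glf a_ge0 well_fin p_ge2 lamh_gt1 uh_gs Nv uh_u0).
Qed.
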